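(* Let $\gamma\colon[0,1]\to\mathbb{R}^2$ be a $\frac12$-Hölder curve. For $i\ge 0$ let $\gamma_i=\overline{\gamma(0),\gamma(2^{-i}),\gamma(2\cdot 2^{-i}),\dots,\gamma(1)}$ be the curve connecting $\gamma(0),\gamma(2^{-i}),\dots,\gamma(1)$ by line segments. For all $i\ge 0$ and $0\le j\le 2^i-1$, let $$\delta_{i,j}(\gamma):=\operatorname{diam}\left\{\gamma\big(j2^{-i}\big),\gamma\big((2j+1)2^{-i-1}\big),\gamma\big((j+1)2^{-i}\big)\right\}.$$ If $$\sigma(\gamma):=\sum_{i=0}^\infty\sum_{j=0}^{2^i-1}\delta_{i,j}(\gamma)^2<\infty,$$ then $A(\gamma)$ exists and $A(\gamma)=\lim_{i\to\infty}A(\gamma_i)$.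
   Context: For a continuous map $\gamma=(\gamma_1,\gamma_2)\colon[a,b]\to\mathbb{R}^2$ and a partition $P=\{t_1,\dots,t_k\}$ with $a=t_1<\dots<t_k=b$, let $$A_P(\gamma)=\frac12\sum_{i=1}^{k-1}\big(\gamma_1(t_i)\gamma_2(t_{i+1})-\gamma_2(t_i)\gamma_1(t_{i+1})\big),$$ and $\operatorname{mesh}(P)=\max_i(t_{i+1}-t_i)$. One says that $A(\gamma)$ (the signed area of $\gamma$) exists if there is $L\in\mathbb{R}$ such that for any $\epsilon>0$ there is $\delta>0$ such that $\operatorname{mesh}(P)<\delta$ implies $|L-A_P(\gamma)|<\epsilon$; then $A(\gamma):=\lim_{\operatorname{mesh}(P)\to0}A_P(\gamma)=L$. (For Lipschitz $\gamma$, $A(\gamma)=\frac12\int(\gamma_1\,\mathrm{d}\gamma_2-\gamma_2\,\mathrm{d}\gamma_1)$.) *)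

(* Defs.v *)
From HB Require Import structures.
From mathcomp Require Import all_boot all_order all_algebra.
From mathcomp Require Import all_classical all_reals all_analysis.

Set Implicit Arguments.
Unset Strict Implicit.
Unset Printing Implicit Defensive.

Import Order.TTheory GRing.Theory Num.Theory.
Import numFieldNormedType.Exports.

Local Open Scope classical_set_scope.
Local Open Scope ring_scope.

(* The library norm on 'rV[R]_n is the sup norm, hence an explicit Euclidean
   distance. *)
Definition eucl_dist (R : realType) (n : nat) (x y : 'rV[R]_n) : R :=
  Num.sqrt (\sum_(k < n) (x 0 k - y 0 k) ^+ 2).

(* Meant for bounded nonempty sets, the real [sup] being 0 otherwise. *)
Definition diam (R : realType) (n : nat) (A : set 'rV[R]_n) : R :=
  sup [set eucl_dist p.1 p.2 | p in A `*` A].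

Definition holder_on (R : realType) (n : nat) (alpha a b : R)
    (f : R -> 'rV[R]_n) : Prop :=
  exists C : R, {in `[a, b] &, forall s t : R,
    eucl_dist (f s) (f t) <= C * `|s - t| `^ alpha}.

(* As in [itv_partition a b s], the partition points are those of a :: s. *)
Definition mesh (R : realType) (a b : R) (s : seq R) : R :=
  let t := nth b (a :: s) in
  \big[Num.max/0]_(0 <= i < size s) (t i.+1 - t i).

Definition area_sum (R : realType) (a b : R) (gamma : R -> 'rV[R]_2)
    (s : seq R) : R :=
  let g := gamma \o nth b (a :: s) in
  2^-1 * \sum_(0 <= i < size s) (g i 0 0 * g i.+1 0 1 - g i 0 1 * g i.+1 0 0).

Definition is_signed_area (R : realType) (a b : R) (gamma : R -> 'rV[R]_2)
    (L : R) : Prop :=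
  forall eps : R, 0 < eps -> exists2 delta : R, 0 < delta &
    forall s : seq R, itv_partition a b s -> mesh a b s < delta ->
      `|L - area_sum a b gamma s| < eps.

Definition signed_area_exists (R : realType) (a b : R)
    (gamma : R -> 'rV[R]_2) : Prop :=
  exists L : R, is_signed_area a b gamma L.

(* 0 when the signed area does not exist. *)
Definition signed_area (R : realType) (a b : R) (gamma : R -> 'rV[R]_2) : R :=
  xget 0 [set L | is_signed_area a b gamma L].

(* The polygonal curve through v 0, ..., v n, parametrized on [0, 1] so that
   v j is reached at time j / n and each segment is affinely parametrized.
   At t = 1 the weight of v n.+1 is 0. *)
Definition polygonal (R : realType) (n : nat) (v : nat -> 'rV[R]_2) (t : R) :
    'rV[R]_2 :=
  let j := Num.truncn (n%:R * t) in
  let u := n%:R * t - j%:R in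
  (1 - u) *: v j + u *: v j.+1.

Definition dyadic_polygonal (R : realType) (gamma : R -> 'rV[R]_2) (i : nat) :
    R -> 'rV[R]_2 :=
  polygonal (2 ^ i) (fun j => gamma (j%:R / 2 ^+ i)).

Definition dyadic_diam (R : realType) (gamma : R -> 'rV[R]_2) (i j : nat) : R :=
  diam [set gamma (j%:R / 2 ^+ i);
            gamma ((2 * j + 1)%:R / 2 ^+ i.+1);
            gamma (j.+1%:R / 2 ^+ i)].

Definition dyadic_sigma (R : realType) (gamma : R -> 'rV[R]_2) : \bar R :=
  (\sum_(0 <= i <oo) (\sum_(0 <= j < 2 ^ i) dyadic_diam gamma i j ^+ 2)%:E)%E.

(* Main.v *)
Require Import Defs.
From HB Require Import structures.
From mathcomp Require Import all_boot all_order all_algebra.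
From mathcomp Require Import all_classical all_reals all_analysis.
From mathcomp Require Import ring lra zify.

(** The area sum of a partition [P] is compared with that of the dyadic partition
    of level [N] by rounding all points of [P] down to multiples of [2 ^- m], for
    [m = N, N + 1, ...].  For [m] tending to infinity the area sum of the rounded
    points tends to that of [P], because the curve is continuous; for [m = N] and
    a mesh smaller than [2 ^- N] it is the dyadic area sum, because every dyadic
    point is hit ([chain_area_steps]).  What remains is to bound the change from
    level [m] to level [m + 1], summed over [m].

    For one gap [s, t] of the partition this change is, up to terms that
    telescope along the partition, the area of a quadrilateral with sides the two
    rounded chords and the displacements of the two endpoints
    ([wedge_quad_le]).  A displacement is bounded by the diameter of the dyadic
    triple of the cell containing the endpoint, and also by the Hoelder condition.
    There are three cases ([swept_area_le]).  If [s] and [t] lie in the same cell,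
    the quadrilateral is degenerate.  If they lie in neighbouring cells, its area
    is at most twice the sum of the squares of the two diameters.  Otherwise the
    gap has length [h >= 2 ^- m], and the area is at most a constant times a
    displacement times the square root of [h].

    The last bound is the delicate one: the Hoelder condition alone gives a
    total of order 1, without any gain for small meshes.  The gain comes from
    [young_scale], which bounds it by a large multiple of the squared diameter
    plus [lam] times a quantity that decays geometrically in [m] once
    [2 ^- m <= h].  For each gap the latter sums up to [lam * h] times a constant
    ([geometric_cutoff_le]), hence to a constant times [lam] over all gaps.  The
    squared diameters are charged only when the partition leaves or enters a
    cell, which for each cell happens at most once ([sum_jumps_left],
    [sum_jumps_right]), so they contribute at most a multiple, depending on [lam],
    of the tail of the series defining sigma.  Choosing first [lam] and then [N]
    makes everything small ([chain_area_near_dyadic]).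

    Since dyadic partitions are partitions too, it follows that the dyadic areas
    converge, and that their limit is the signed area
    ([signed_area_dyadic_limit]).  A polygonal curve is Lipschitz and so
    falls under the same result; the dyadic areas of the [i]-th polygonal
    approximation are constant from level [i] on, and equal to the dyadic area of
    level [i] of the curve itself ([is_signed_area_polygonal]).  Hence the signed
    areas of the approximations are the dyadic areas of the curve. *)

Set Implicit Arguments.
Unset Strict Implicit.
Unset Printing Implicit Defensive.

Import Order.TTheory GRing.Theory Num.Theory.
Import numFieldNormedType.Exports.

Local Open Scope classical_set_scope.
Local Open Scope ring_scope.

(** * Areas of triangles and chains *)

(** The signed area of the triangle [0, p, q]; the area sum of a partition is
    the sum of these over consecutive points. *)
Definition wedge (R : realType) (p q : 'rV[R]_2) : R :=
  2^-1 * (p 0 0 * q 0 1 - p 0 1 * q 0 0).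

Definition chain_area (R : realType) (v : nat -> 'rV[R]_2) (n : nat) : R :=
  \sum_(0 <= i < n) wedge (v i) (v i.+1).

Lemma area_sumE (R : realType) (a b : R) (gamma : R -> 'rV[R]_2) (s : seq R) :
  area_sum a b gamma s = chain_area (gamma \o nth b (a :: s)) (size s).
Proof. by rewrite /area_sum /chain_area mulr_sumr. Qed.

Lemma wedgexx (R : realType) (p : 'rV[R]_2) : wedge p p = 0.
Proof. by rewrite /wedge; ring. Qed.

Lemma coord_norm_le (R : realType) (u : 'rV[R]_2) (k : 'I_2) :
  `|u 0 k| <= `|u|.
Proof.
rewrite [leRHS]mx_normrE.
exact: (le_bigmax _ (fun ij : 'I_1 * 'I_2 => `|u ij.1 ij.2|) (0, k)).
Qed.

Lemma wedge_le (R : realType) (u v : 'rV[R]_2) : `|wedge u v| <= `|u| * `|v|.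
Proof.
have H (i j : 'I_2) : `|u 0 i * v 0 j| <= `|u| * `|v|.
  by rewrite normrM ler_pM ?coord_norm_le.
rewrite /wedge normrM ger0_norm ?invr_ge0//.
have := le_trans (ler_normB _ _) (lerD (H 0 1) (H 1 0)).
lra.
Qed.

Lemma wedge_quad (R : realType) (a a' b b' : 'rV[R]_2) :
  wedge a' b' - wedge a b + (wedge a a' - wedge b b') =
  wedge (a' - a) (b' - a) + wedge (b' - b) (b - a).
Proof. by rewrite /wedge !mxE; field. Qed.

(** Up to the two terms [wedge a a'] and [wedge b b'], which telescope along a
    partition, replacing the chord [a b] by [a' b'] changes the area by that of
    the quadrilateral [a, a', b', b].  Cut along the diagonal [a b'], it is
    controlled by the displacements [a' - a] and [b' - b]. *)
Lemma wedge_quad_le (R : realType) (a a' b b' : 'rV[R]_2) :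
  `|wedge a' b' - wedge a b + (wedge a a' - wedge b b')| <=
  (`|a' - a| + `|b' - b|) * `|b - a| + `|a' - a| * `|b' - b|.
Proof.
rewrite wedge_quad (le_trans (ler_normD _ _))//.
have h1 := wedge_le (a' - a) (b' - a).
have h2 := wedge_le (b' - b) (b - a).
have h3 : `|b' - a| <= `|b' - b| + `|b - a|.
  by rewrite -(subrK b b') -addrA (le_trans _ (ler_normD _ _))// addrK.
have := ler_wpM2l (normr_ge0 (a' - a)) h3.
nra.
Qed.

(** * Monotone integer sequences *)

(** A monotone integer sequence leaves each integer at most once, so summing
    over the jumps counts each value of [F] at most once.  This is what prevents
    a dyadic cell from being charged once for every partition point in it. *)
Lemma sum_jumps_left (R : realType) (F : nat -> R) (c : nat -> nat) (n : nat) :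
  (forall j, 0 <= F j) ->
  (forall i, (i < n)%N -> (c i <= c i.+1)%N) ->
  \sum_(0 <= i < n) (c i < c i.+1)%N%:R * F (c i) <=
  \sum_(0 <= j < c n) F j.
Proof.
move=> F0; elim: n => [|n IH] cm; first by rewrite big_nil sumr_ge0.
rewrite big_nat_recr//=; have cn := cm n (leqnn _).
have {}IH := IH (fun i lin => cm i (ltnW lin)).
rewrite [leRHS](@big_cat_nat _ _ _ (c n))//= lerD//.
case: ltnP => h; rewrite ?mul1r ?mul0r ?sumr_ge0//.
by rewrite (big_ltn h) lerDl sumr_ge0.
Qed.

Lemma sum_jumps_right (R : realType) (F : nat -> R) (c : nat -> nat) (n : nat) :
  (forall j, 0 <= F j) ->
  (forall i, (i < n)%N -> (c i <= c i.+1)%N) ->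
  \sum_(0 <= i < n) (c i < c i.+1)%N%:R * F (c i.+1) <=
  \sum_(0 <= j < (c n).+1) F j.
Proof.
move=> F0; elim: n => [|n IH] cm; first by rewrite big_nil sumr_ge0.
rewrite big_nat_recr//=; have cn := cm n (leqnn _).
have {}IH := IH (fun i lin => cm i (ltnW lin)).
rewrite [leRHS](@big_cat_nat _ _ _ (c n).+1)//= lerD//.
case: ltnP => h; rewrite ?mul1r ?mul0r ?sumr_ge0//.
by rewrite big_nat_recr//= lerDr sumr_ge0.
Qed.

(** Skipping no vertex, the sequence [c] runs through the polygon [v] at varying
    speed, and its pauses contribute the degenerate wedges [wedge p p]. *)
Lemma chain_area_steps (R : realType) (v : nat -> 'rV[R]_2) (c : nat -> nat)
    (n : nat) :
  c 0%N = 0%N ->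
  (forall i, (i < n)%N -> (c i <= c i.+1 <= (c i).+1)%N) ->
  chain_area (v \o c) n = chain_area v (c n).
Proof.
rewrite /chain_area => c0; elim: n => [|n IH] cm; first by rewrite c0 !big_nil.
rewrite big_nat_recr//= IH; last by move=> i lin; exact/cm/ltnW.
have /andP[] := cm n (leqnn _).
rewrite leq_eqVlt => /orP[/eqP <- _|h1 h2]; first by rewrite wedgexx addr0.
have -> : c n.+1 = (c n).+1 by apply/eqP; rewrite eqn_leq h1 h2.
by rewrite big_nat_recr.
Qed.

(** * Summation over scales *)

(** The three variables stand for fourth roots of lengths: [del] is an
    oscillation of the curve at scale [x ^+ 4], and [eta ^+ 4] is the length of a
    partition gap.  Young's inequality alone gives an error
    [lam * eta ^+ 4] at each scale, which cannot be summed over infinitely many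
    scales; the factor [x] in place of an [eta] makes the error geometric.  At
    scales [x] much smaller than [eta], the Hoelder bound on [del] suffices;
    otherwise [lam * eta] is at most [C * x] and Young's inequality is used. *)
Lemma young_scale (R : realType) (C lam del x eta : R) :
  0 < C -> 0 < lam -> 0 <= del -> 0 <= x -> 0 <= eta -> del <= C * x ^+ 2 ->
  del * eta ^+ 2 <= C / (4 * lam ^+ 2) * del ^+ 2 + lam * eta ^+ 3 * x.
Proof.
move=> C0 lam0 del0 x0 eta0 hdel.
have [h|h] := leP (C * x) (lam * eta).
  apply: (@le_trans _ _ (lam * eta ^+ 3 * x)); last first.
    by rewrite lerDr mulr_ge0 ?sqr_ge0// divr_ge0 ?mulr_ge0 ?sqr_ge0 ?ltW.
  apply: (le_trans (ler_wpM2r (sqr_ge0 eta) hdel)).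
  have -> : C * x ^+ 2 * eta ^+ 2 = C * x * (x * eta ^+ 2) by ring.
  have -> : lam * eta ^+ 3 * x = lam * eta * (x * eta ^+ 2) by ring.
  by rewrite ler_wpM2r// mulr_ge0 ?sqr_ge0.
apply: (@le_trans _ _ (C / (4 * lam ^+ 2) * del ^+ 2
                       + lam ^+ 2 / C * eta ^+ 4)); last first.
  rewrite lerD2l.
  have -> : lam ^+ 2 / C * eta ^+ 4 = lam * eta ^+ 3 * (lam * eta / C).
    by field; rewrite gt_eqF.
  rewrite ler_wpM2l ?mulr_ge0 ?exprn_ge0 ?(ltW lam0)//.
  by rewrite ler_pdivrMr// [leRHS]mulrC ltW.
rewrite -subr_ge0.
have -> : C / (4 * lam ^+ 2) * del ^+ 2 + lam ^+ 2 / C * eta ^+ 4 -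
    del * eta ^+ 2 = C / (4 * lam ^+ 2) * (del - 2 * lam ^+ 2 / C * eta ^+ 2) ^+ 2.
  by field; rewrite !gt_eqF.
by rewrite mulr_ge0 ?sqr_ge0// divr_ge0 ?mulr_ge0 ?sqr_ge0 ?ltW.
Qed.

(** The sum of a geometric sequence from its first term below [eta] on is
    comparable to that term. *)
Lemma geometric_cutoff_le (R : realType) (rho eta : R) (n : nat) :
  0 < rho < 1 -> 0 <= eta ->
  \sum_(0 <= m < n) (rho ^+ m <= eta)%R%:R * rho ^+ m <= eta / (1 - rho).
Proof.
move=> /andP[r0 r1]; have r1' : 0 < 1 - rho by rewrite subr_gt0.
elim: n eta => [|n IH] eta eta0; first by rewrite big_nil divr_ge0// ltW.
have [e1|e1] := leP 1 eta.
  apply: (@le_trans _ _ (series (geometric 1 rho) n.+1)).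
    apply: ler_sum => i _; rewrite /geometric/= mul1r.
    by case: (_ <= eta); rewrite ?mul1r ?mul0r// exprn_ge0// ltW.
  apply: (le_trans (geometric_le_lim n.+1 ler01 r0 _)).
    by rewrite ger0_norm ?ltW.
  by rewrite ler_pM2r ?invr_gt0.
rewrite big_nat_recl//= expr0 (leNgt 1) e1 mul0r add0r.
have /IH : 0 <= eta / rho by rewrite divr_ge0// ltW.
move=> /(ler_wpM2l (ltW r0)).
have -> : rho * (eta / rho / (1 - rho)) = eta / (1 - rho).
  by field; rewrite !gt_eqF.
rewrite mulr_sumr; apply: le_trans; apply: ler_sum => i _.
by rewrite exprS ler_pdivlMr// [rho ^+ i * rho]mulrC mulrCA.
Qed.

(** * Dyadic cells *)

Definition cell (R : realType) (m : nat) (t : R) : nat := Num.truncn (2 ^+ m * t).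

Definition dyadic_point (R : realType) (gamma : R -> 'rV[R]_2) (m j : nat) :=
  gamma (j%:R / 2 ^+ m).

Lemma exp2_gt0 (R : realType) (m : nat) : 0 < 2 ^+ m :> R.
Proof. exact: exprn_gt0. Qed.

Lemma cell0 (R : realType) (m : nat) : cell m (0 : R) = 0%N.
Proof. by rewrite /cell mulr0 truncn0. Qed.

Lemma cell1 (R : realType) (m : nat) : cell m (1 : R) = (2 ^ m)%N.
Proof. by rewrite /cell mulr1 -natrX natrK. Qed.

Lemma cell_homo (R : realType) (m : nat) (s t : R) :
  s <= t -> (cell m s <= cell m t)%N.
Proof. by move=> st; rewrite le_truncn// ler_pM2l// exp2_gt0. Qed.

Lemma cell_le (R : realType) (m : nat) (t : R) : t <= 1 -> (cell m t <= 2 ^ m)%N.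
Proof. by rewrite -(cell1 R m); exact: cell_homo. Qed.

Lemma cell_itv (R : realType) (m : nat) (t : R) : 0 <= t ->
  (cell m t)%:R / 2 ^+ m <= t < (cell m t)%:R / 2 ^+ m + 2 ^- m.
Proof.
move=> t0; rewrite -{3}[2 ^- m]mul1r -mulrDl.
rewrite ler_pdivrMr ?ltr_pdivlMr ?exp2_gt0// natr1 [t * _]mulrC.
by rewrite truncn_itv// mulr_ge0// ltW// exp2_gt0.
Qed.

Lemma cellS (R : realType) (m : nat) (t : R) : 0 <= t ->
  (2 * cell m t <= cell m.+1 t <= 2 * cell m t + 1)%N.
Proof.
move=> t0; have m0 := exp2_gt0 R m.
have x0 : 0 <= 2 ^+ m * t by rewrite mulr_ge0// ltW.
have /andP[h1 h2] := truncn_itv x0.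
rewrite /cell exprS -mulrA truncn_ge_nat ?mulr_ge0// truncn_le_nat.
by move: h2; rewrite -natr1 -[X in _ -> _ && (_ < X)]natr1 natrD !natrM; lra.
Qed.

Lemma cell_succ_le (R : realType) (m : nat) (s t : R) : 0 <= s -> 
  t - s < 2 ^- m -> (cell m t <= (cell m s).+1)%N.
Proof.
move=> s0 h; have /andP[_ h2] := cell_itv m s0.
rewrite /cell truncn_le_nat mulrC -ltr_pdivlMr ?exp2_gt0//.
by rewrite -[_.+2%:R]natr1 -[_.+1%:R]natr1 !mulrDl mul1r; lra.
Qed.

Lemma cell_gap (R : realType) (m : nat) (s t : R) : 0 <= s -> 0 <= t ->
  ((cell m s).+1 < cell m t)%N -> 2 ^- m <= t - s.
Proof.
move=> s0 t0; rewrite ltnNge => h; rewrite leNgt; apply: contra h.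
exact: cell_succ_le.
Qed.

Lemma dyadic_itv (R : realType) (m j : nat) : (j <= 2 ^ m)%N ->
  0 <= (j%:R / 2 ^+ m : R) <= 1.
Proof.
move=> jm; rewrite divr_ge0 ?ler0n ?ler_pdivrMr ?exp2_gt0//=.
by rewrite mul1r -natrX ler_nat.
Qed.

Lemma dyadic_double (R : realType) (m j : nat) :
  (2 * j)%:R / 2 ^+ m.+1 = j%:R / 2 ^+ m :> R.
Proof. by rewrite exprS natrM; field; rewrite gt_eqF ?exp2_gt0. Qed.

Lemma dyadic_point_double (R : realType) (gamma : R -> 'rV[R]_2) m j :
  dyadic_point gamma m.+1 (2 * j) = dyadic_point gamma m j.
Proof. by rewrite /dyadic_point dyadic_double. Qed.

(** * Diameters *)

Lemma eucl_dist_ge (R : realType) (p q : 'rV[R]_2) : `|p - q| <= eucl_dist p q.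
Proof.
rewrite [leLHS]mx_normrE; apply/bigmax_leP; split; first exact: sqrtr_ge0.
move=> [i k] _ /=; rewrite ord1 -sqrtr_sqr ler_sqrt ?sumr_ge0//; last first.
  by move=> l _; exact: sqr_ge0.
rewrite (bigD1 k)//= !mxE lerDl sumr_ge0// => l _; exact: sqr_ge0.
Qed.

Lemma eucl_dist_le (R : realType) (p q : 'rV[R]_2) :
  eucl_dist p q <= 2 * `|p - q|.
Proof.
have n0 := normr_ge0 (p - q).
rewrite -[leRHS]ger0_norm ?mulr_ge0// -sqrtr_sqr ler_sqrt ?sqr_ge0//.
rewrite big_ord_recl big_ord1.
have H k : (p 0 k - q 0 k) ^+ 2 <= `|p - q| ^+ 2.
  rewrite -[leLHS]real_normK ?num_real// lerXn2r ?nnegrE//.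
  by have := coord_norm_le (p - q) k; rewrite !mxE.
have := lerD (H ord0) (H (lift ord0 ord0)).
by move=> /le_trans; apply; rewrite exprMn; have := sqr_ge0 `|p - q|; lra.
Qed.

(** The norm on the left is the supremum norm, which the Euclidean distance
    dominates. *)
Lemma le_diam3 (R : realType) (a b c p q : 'rV[R]_2) :
  [set a; b; c] p -> [set a; b; c] q -> `|p - q| <= diam [set a; b; c].
Proof.
move=> hp hq; apply: (le_trans (eucl_dist_ge _ _)).
apply: ub_le_sup; last by exists (p, q).
exists (4 * (`|a| + `|b| + `|c|)) => _ [[u v] [/= hu hv] <-] /=.
have bound w : [set a; b; c] w -> `|w| <= `|a| + `|b| + `|c|.
  have := (normr_ge0 a, normr_ge0 b, normr_ge0 c).
  by move=> [[? ?] ?] [[->|->]|->]; lra.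
have := eucl_dist_le u v; have := ler_normB u v.
by have := (bound _ hu, bound _ hv) => -[? ?]; lra.
Qed.

Lemma diam3_le (R : realType) (a b c : 'rV[R]_2) (K : R) :
  (forall p q, [set a; b; c] p -> [set a; b; c] q -> eucl_dist p q <= K) ->
  diam [set a; b; c] <= K.
Proof.
move=> H; apply: ge_sup; first by exists (eucl_dist a a), (a, a); split; left; left.
by move=> _ [[p q] [/= hp hq] <-]; exact: H.
Qed.

(** * Refining the rounding of a gap *)

(** The fourth root of 1/2: with [x = dyadic_ratio R ^+ m], the scale [2 ^- m] is
    [x ^+ 4] and its square root [x ^+ 2], so that the estimates are polynomial in
    [x]. *)
Definition dyadic_ratio (R : realType) : R := Num.sqrt (Num.sqrt 2^-1).

Lemma sqrt4 (R : realType) (x : R) : 0 <= x -> Num.sqrt (Num.sqrt x) ^+ 4 = x.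
Proof. by move=> x0; rewrite (exprM _ 2 2) !sqr_sqrtr// sqrtr_ge0. Qed.

Lemma dyadic_ratio_itv (R : realType) : 0 < dyadic_ratio R < 1.
Proof.
rewrite !sqrtr_gt0 invr_gt0 ltr0n/=.
rewrite -(@ltr_pXn2r _ 4)// ?nnegrE ?sqrtr_ge0// sqrt4 ?invr_ge0// expr1n.
by rewrite invf_lt1// ltr1n.
Qed.

Lemma dyadic_ratioX4 (R : realType) m : (dyadic_ratio R ^+ m) ^+ 4 = 2 ^- m.
Proof. by rewrite exprAC sqrt4 ?invr_ge0// exprVn. Qed.

Lemma dyadic_ratioX_ge0 (R : realType) m : 0 <= dyadic_ratio R ^+ m.
Proof. by rewrite exprn_ge0// ltW//; case/andP: (dyadic_ratio_itv R). Qed.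

(** The 1/2-Hoelder condition without square roots: [x] is a fourth root of a
    bound on the distance of the parameters. *)
Definition half_holder (R : realType) (C : R) (gamma : R -> 'rV[R]_2) : Prop :=
  forall s t x : R, 0 <= s <= 1 -> 0 <= t <= 1 -> 0 <= x ->
    `|s - t| <= x ^+ 4 -> `|gamma s - gamma t| <= C * x ^+ 2.

Lemma dyadic_diam_mid (R : realType) (gamma : R -> 'rV[R]_2) m j :
  `|dyadic_point gamma m.+1 (2 * j + 1) - dyadic_point gamma m j| <=
  dyadic_diam gamma m j.
Proof. by apply: le_diam3; [left; right|left; left]. Qed.

Lemma dyadic_diam_edge (R : realType) (gamma : R -> 'rV[R]_2) m j :
  `|dyadic_point gamma m j.+1 - dyadic_point gamma m j| <= dyadic_diam gamma m j.
Proof. by apply: le_diam3; [right|left; left]. Qed.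

Lemma dyadic_diam_ge0 (R : realType) (gamma : R -> 'rV[R]_2) m j :
  0 <= dyadic_diam gamma m j.
Proof. exact: le_trans (normr_ge0 _) (dyadic_diam_edge _ _ _). Qed.

(** At [t = 1] the cell index is [2 ^ m], beyond the last dyadic interval; since
    rounding fixes 1, the value 0 is right there. *)
Definition cell_diam (R : realType) (gamma : R -> 'rV[R]_2) (m j : nat) : R :=
  if (j < 2 ^ m)%N then dyadic_diam gamma m j else 0.

Lemma cell_diam_ge0 (R : realType) (gamma : R -> 'rV[R]_2) m j :
  0 <= cell_diam gamma m j.
Proof. by rewrite /cell_diam; case: ifP => // _; exact: dyadic_diam_ge0. Qed.

Definition rounded (R : realType) (gamma : R -> 'rV[R]_2) (m : nat) (t : R) :=
  dyadic_point gamma m (cell m t).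

Lemma rounded_step_le_diam (R : realType) (gamma : R -> 'rV[R]_2) m (t : R) :
  0 <= t <= 1 ->
  `|rounded gamma m.+1 t - rounded gamma m t| <= cell_diam gamma m (cell m t).
Proof.
move=> /andP[t0 t1]; have /andP[h1 h2] := cellS m t0.
have h3 := cell_le m.+1 t1; rewrite expnS in h3.
have [E|E] := eqVneq (cell m.+1 t) (2 * cell m t)%N.
  by rewrite /rounded E dyadic_point_double subrr normr0 cell_diam_ge0.
have {}E : cell m.+1 t = (2 * cell m t + 1)%N by lia.
rewrite /rounded E /cell_diam ifT; last by lia.
exact: dyadic_diam_mid.
Qed.

Lemma rounded_step_le_holder (R : realType) (gamma : R -> 'rV[R]_2) C m (t : R) :
  half_holder C gamma -> 0 <= t <= 1 ->
  `|rounded gamma m.+1 t - rounded gamma m t| <= C * (dyadic_ratio R ^+ m) ^+ 2.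
Proof.
move=> H /andP[t0 t1]; apply: H.
- by apply: dyadic_itv; exact: cell_le.
- by apply: dyadic_itv; exact: cell_le.
- exact: dyadic_ratioX_ge0.
rewrite dyadic_ratioX4.
have /andP[h1 h2] := cell_itv m.+1 t0.
have /andP[h3 h4] := cell_itv m t0.
have h5 : 2 ^- m.+1 <= 2 ^- m :> R.
  by rewrite lef_pV2 ?posrE ?exp2_gt0// ler_eXn2l// ltr1n.
by rewrite ler_norml; apply/andP; split; lra.
Qed.

Lemma rounded_chord_le_holder (R : realType) (gamma : R -> 'rV[R]_2) C m
    (s t eta : R) :
  half_holder C gamma -> 0 <= s -> s <= t -> t <= 1 -> 0 <= eta ->
  eta ^+ 4 = t - s -> 2 ^- m <= t - s ->
  `|rounded gamma m t - rounded gamma m s| <= 4 * C * eta ^+ 2.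
Proof.
move=> H s0 st t1 eta0 Eeta hm.
have t0 := le_trans s0 st; have s1 := le_trans st t1.
have -> : 4 * C * eta ^+ 2 = C * (2 * eta) ^+ 2 by ring.
apply: H.
- by apply: dyadic_itv; exact: cell_le.
- by apply: dyadic_itv; exact: cell_le.
- by rewrite mulr_ge0.
have -> : (2 * eta) ^+ 4 = 16 * eta ^+ 4 by ring.
rewrite Eeta.
have /andP[h1 h2] := cell_itv m s0.
have /andP[h3 h4] := cell_itv m t0.
by rewrite ler_norml; apply/andP; split; lra.
Qed.

(** The area of the quadrilateral between the chords of a gap [s, t] rounded to
    levels [m] and [m.+1].  The last two wedges depend on one endpoint each, so
    they cancel between neighbouring gaps. *)
Definition swept_area (R : realType) (gamma : R -> 'rV[R]_2) m (s t : R) : R :=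
  wedge (rounded gamma m.+1 s) (rounded gamma m.+1 t)
  - wedge (rounded gamma m s) (rounded gamma m t)
  + (wedge (rounded gamma m s) (rounded gamma m.+1 s)
     - wedge (rounded gamma m t) (rounded gamma m.+1 t)).

(** All four vertices lie on one line: they are the left endpoint of the cell or
    the image of its midpoint. *)
Lemma swept_area_same_cell (R : realType) (gamma : R -> 'rV[R]_2) m (s t : R) :
  0 <= s -> s <= t -> cell m s = cell m t -> swept_area gamma m s t = 0.
Proof.
move=> s0 st E; have t0 := le_trans s0 st.
have /andP[h1 h2] := cellS m s0; have /andP[h3 h4] := cellS m t0.
have h5 := cell_homo m.+1 st.
rewrite /swept_area wedge_quad /rounded E subrr.
have [E1|E1] := eqVneq (cell m.+1 s) (2 * cell m s)%N.
  by rewrite E1 dyadic_point_double E subrr /wedge !mxE; ring.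
have -> : cell m.+1 s = cell m.+1 t by lia.
by rewrite wedgexx /wedge !mxE; ring.
Qed.

(** The total weight with which the squared diameter of a cell enters when a
    partition gap jumps out of the cell: 2 if the jump is to the next cell, the
    rest from [young_scale]. *)
Definition jump_weight (R : realType) (C lam : R) : R :=
  2 + 5 * C * (C / (4 * lam ^+ 2)).

Lemma jump_weight_gt0 (R : realType) (C lam : R) :
  0 < C -> 0 < jump_weight C lam.
Proof.
move=> C0; have lam2 : 0 <= 4 * lam ^+ 2 by rewrite mulr_ge0// sqr_ge0.
by rewrite ltr_wpDr// mulr_ge0 ?divr_ge0// ?mulr_ge0// ltW.
Qed.

(** For a gap that jumps to the next cell, the vertices of the quadrilateral
    belong to the dyadic triples of two neighbouring cells, so its area is bounded
    by the squared diameters of these triples even if the gap is much shorter than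
    [2 ^- m].  A gap that jumps over a whole cell has length at least [2 ^- m];
    then the rounded chord is at most of order [eta ^+ 2] by the Hoelder
    condition, and [young_scale] bounds its product with a displacement. *)
Lemma swept_area_le (R : realType) (gamma : R -> 'rV[R]_2) (C lam : R) m
    (s t eta : R) :
  half_holder C gamma -> 0 < C -> 0 < lam ->
  0 <= s -> s <= t -> t <= 1 -> 0 <= eta -> eta ^+ 4 = t - s ->
  `|swept_area gamma m s t| <=
  jump_weight C lam * ((cell m s < cell m t)%N%:R * 
    (cell_diam gamma m (cell m s) ^+ 2 + cell_diam gamma m (cell m t) ^+ 2))
  + 10 * C * lam * (eta ^+ 3 *
      ((dyadic_ratio R ^+ m <= eta)%R%:R * dyadic_ratio R ^+ m)).
Proof.
move=> H C0 lam0 s0 st t1 eta0 Eeta.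
have t0 := le_trans s0 st; have s1 := le_trans st t1.
have K0 : 0 <= C / (4 * lam ^+ 2).
  by rewrite divr_ge0 ?mulr_ge0 ?sqr_ge0// ltW.
have jw : 2 <= jump_weight C lam.
  by rewrite lerDl (mulr_ge0 _ K0)// mulr_ge0// ltW.
set x := dyadic_ratio R ^+ m; have x0 : 0 <= x := dyadic_ratioX_ge0 R m.
have tail0 : 0 <= 10 * C * lam * (eta ^+ 3 * ((x <= eta)%R%:R * x)).
  by rewrite !mulr_ge0 ?ler0n ?(exprn_ge0 3 eta0)// ltW.
have := cell_homo m st; rewrite leq_eqVlt => /orP[/eqP E|clt].
  by rewrite swept_area_same_cell// normr0 E ltnn mul0r mulr0 add0r.
rewrite clt mul1r.
apply: (le_trans (wedge_quad_le _ _ _ _)).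
have hs : 0 <= s <= 1 by rewrite s0.
have ht : 0 <= t <= 1 by rewrite t0.
have ad := rounded_step_le_diam gamma m hs.
have bd := rounded_step_le_diam gamma m ht.
have aC := rounded_step_le_holder m H hs.
have bC := rounded_step_le_holder m H ht.
move: ad bd aC bC; rewrite -/x.
set al := `|_ - _|; set be := `|_ - _| => ad bd aC bC.
set u := cell_diam _ _ _ in ad *; set v := cell_diam _ _ _ in bd *.
have al0 : 0 <= al by exact: normr_ge0.
have be0 : 0 <= be by exact: normr_ge0.
have [far|near] := ltnP (cell m s).+1 (cell m t); last first.
  have E : cell m t = (cell m s).+1 by apply/eqP; rewrite eqn_leq near clt.
  (* The chord joins the endpoints of the cell of [s]. *)
  have hD : `|rounded gamma m t - rounded gamma m s| <= u.
    rewrite /rounded E /u /cell_diam ifT ?dyadic_diam_edge//.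
    exact: leq_trans clt (cell_le m t1).
  set D := `|_ - _| in hD *.
  have D0 : 0 <= D by exact: normr_ge0.
  apply: (@le_trans _ _ (2 * (u ^+ 2 + v ^+ 2))).
    have h1 : (al + be) * D <= (u + v) * u by rewrite ler_pM// ?addr_ge0// lerD.
    have h2 : al * be <= u * v by rewrite ler_pM.
    have := sqr_ge0 (u - v); nra.
  apply: (@le_trans _ _ (jump_weight C lam * (u ^+ 2 + v ^+ 2))).
    by rewrite ler_wpM2r// addr_ge0// sqr_ge0.
  by rewrite lerDl.
(* The gap jumps over at least one whole cell. *)
have hm := cell_gap s0 t0 far.
have xe : x <= eta.
  by rewrite -(@ler_pXn2r _ 4)// ?nnegrE// dyadic_ratioX4 Eeta.
have hD := rounded_chord_le_holder H s0 st t1 eta0 Eeta hm.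
set D := `|_ - _| in hD *.
have D0 : 0 <= D by exact: normr_ge0.
rewrite xe mul1r.
have ya := young_scale C0 lam0 al0 x0 eta0 aC.
have yb := young_scale C0 lam0 be0 x0 eta0 bC.
have au : al ^+ 2 <= u ^+ 2 by rewrite ler_pXn2r// nnegrE (le_trans al0).
have bv : be ^+ 2 <= v ^+ 2 by rewrite ler_pXn2r// nnegrE (le_trans be0).
have xe2 : x ^+ 2 <= eta ^+ 2 by rewrite ler_pXn2r// nnegrE.
(* 4 from the chord, 1 from the product of the displacements, as [x <= eta]. *)
have h1 : (al + be) * D + al * be <= 5 * C * ((al + be) * eta ^+ 2).
  have p1 : (al + be) * D <= (al + be) * (4 * C * eta ^+ 2).
    by rewrite ler_wpM2l// addr_ge0.
  have p2 : al * be <= al * (C * eta ^+ 2).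
    by rewrite ler_wpM2l// (le_trans bC)// ler_wpM2l// ltW.
  have p3 : 0 <= be * (C * eta ^+ 2) by rewrite !mulr_ge0 ?sqr_ge0// ltW.
  nra.
apply: (le_trans h1).
set K := C / (4 * lam ^+ 2) in K0 ya yb *.
have h2 : (al + be) * eta ^+ 2 <=
    K * (u ^+ 2 + v ^+ 2) + 2 * (lam * eta ^+ 3 * x).
  have := ler_wpM2l K0 au; have := ler_wpM2l K0 bv; lra.
have C5 : 0 <= 5 * C by rewrite mulr_ge0// ltW.
apply: (le_trans (ler_wpM2l C5 h2)).
rewrite /jump_weight -/K.
have := sqr_ge0 u; have := sqr_ge0 v; lra.
Qed.

(** * Refining the rounding of a subdivision *)

Definition level_energy (R : realType) (gamma : R -> 'rV[R]_2) (m : nat) : R :=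
  \sum_(0 <= j < 2 ^ m) dyadic_diam gamma m j ^+ 2.

Definition gap_root (R : realType) (t : nat -> R) (i : nat) : R :=
  Num.sqrt (Num.sqrt (t i.+1 - t i)).

Definition subdivision (R : realType) (t : nat -> R) (n : nat) : Prop :=
  [/\ t 0%N = 0, t n = 1 & forall i, (i < n)%N -> t i <= t i.+1].

Lemma subdivision_itv (R : realType) (t : nat -> R) (n i : nat) :
  subdivision t n -> (i <= n)%N -> 0 <= t i <= 1.
Proof.
move=> [t0 tn tm] lin.
have H j k : (j <= k <= n)%N -> t j <= t k.
  elim: k => [|k IH] /andP[jk kn]; first by move: jk; rewrite leqn0 => /eqP->.
  move: jk; rewrite leq_eqVlt => /orP[/eqP -> //|jk].
  by rewrite (le_trans (IH _)) ?tm// -ltnS jk ltnW.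
by rewrite -{1}t0 -tn !H ?lin ?leqnn.
Qed.

Lemma rounded0 (R : realType) (gamma : R -> 'rV[R]_2) m :
  rounded gamma m 0 = gamma 0.
Proof. by rewrite /rounded cell0 /dyadic_point mul0r. Qed.

Lemma rounded1 (R : realType) (gamma : R -> 'rV[R]_2) m :
  rounded gamma m 1 = gamma 1.
Proof. by rewrite /rounded cell1 /dyadic_point natrX divff// gt_eqF// exp2_gt0. Qed.

Lemma sum_cell_diam (R : realType) (gamma : R -> 'rV[R]_2) m :
  \sum_(0 <= j < 2 ^ m) cell_diam gamma m j ^+ 2 = level_energy gamma m.
Proof. by apply: eq_big_nat => j /andP[_ h]; rewrite /cell_diam h. Qed.

(** The areas swept by the gaps are added up.  Each cell is charged at most twice,
    once as the cell of a left endpoint and once as that of a right one. *)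
Lemma chain_area_level_step (R : realType) (gamma : R -> 'rV[R]_2) (C lam : R)
    (m : nat) (t : nat -> R) (n : nat) :
  half_holder C gamma -> 0 < C -> 0 < lam -> subdivision t n ->
  `|chain_area (rounded gamma m.+1 \o t) n -
    chain_area (rounded gamma m \o t) n| <=
  jump_weight C lam * (2 * level_energy gamma m) +
  10 * C * lam * \sum_(0 <= i < n) gap_root t i ^+ 3 *
    ((dyadic_ratio R ^+ m <= gap_root t i)%R%:R * dyadic_ratio R ^+ m).
Proof.
move=> H C0 lam0 tP; have [t0 tn tm] := tP.
have -> : chain_area (rounded gamma m.+1 \o t) n -
    chain_area (rounded gamma m \o t) n =
    \sum_(0 <= i < n) swept_area gamma m (t i) (t i.+1).
  rewrite /chain_area -sumrB.
  pose W (i : nat) := wedge (rounded gamma m (t i)) (rounded gamma m.+1 (t i)).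
  (* [W] vanishes at both ends, since rounding fixes 0 and 1. *)
  have := telescope_sumr W (leq0n n).
  have -> : W n - W 0%N = 0.
    by rewrite /W t0 tn !rounded0 !rounded1 !wedgexx subrr.
  move=> W0; rewrite -[LHS]subr0 -[X in _ - X = _]W0 -sumrB; apply: eq_bigr => i _ /=.
  by rewrite /swept_area /W opprB.
rewrite (le_trans (ler_norm_sum _ _ _))//.
pose G i := cell_diam gamma m (cell m (t i)) ^+ 2.
pose ct i := cell m (t i).
apply: (@le_trans _ _ (\sum_(0 <= i < n)
  (jump_weight C lam * ((ct i < ct i.+1)%N%:R * (G i + G i.+1)) +
   10 * C * lam * (gap_root t i ^+ 3 *
    ((dyadic_ratio R ^+ m <= gap_root t i)%R%:R * dyadic_ratio R ^+ m))))).
  apply: ler_sum_nat => i /andP[_ lin].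
  have /andP[h1 _] := subdivision_itv tP (ltnW lin).
  have /andP[_ h2] := subdivision_itv tP lin.
  apply: swept_area_le => //; first exact: tm.
    exact: sqrtr_ge0.
  by rewrite sqrt4// subr_ge0 tm.
rewrite big_split/= -!mulr_sumr lerD2r.
have K0 : 0 <= jump_weight C lam.
  by rewrite ltW// jump_weight_gt0.
rewrite ler_wpM2l//.
have F0 j : 0 <= cell_diam gamma m j ^+ 2 by rewrite sqr_ge0.
have cm i : (i < n)%N -> (ct i <= ct i.+1)%N.
  by move=> lin; rewrite /ct cell_homo// tm.
have hL := sum_jumps_left F0 cm; have hR := sum_jumps_right F0 cm.
have cn : ct n = (2 ^ m)%N by rewrite /ct tn cell1.
rewrite cn sum_cell_diam in hL.
rewrite cn big_nat_recr//= sum_cell_diam {2}/cell_diam ltnn expr0n addr0 in hR.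
under eq_bigr do rewrite mulrDr.
by rewrite big_split/= [leRHS](_ : _ = level_energy gamma m + level_energy gamma m)
  ?lerD//; ring.
Qed.

Lemma gap_root_sum (R : realType) (t : nat -> R) (n : nat) :
  subdivision t n -> \sum_(0 <= i < n) gap_root t i ^+ 4 = 1.
Proof.
move=> [t0 tn tm].
rewrite (eq_big_nat _ _ (F2 := fun i => t i.+1 - t i)); last first.
  by move=> i /andP[_ lin]; rewrite sqrt4// subr_ge0 tm.
by rewrite telescope_sumr// t0 tn subr0.
Qed.

(** The last term of the previous estimate is summed over the levels for each
    gap separately: only levels finer than the gap occur, so the geometric sum is
    at most [gap_root t i] up to a factor, and what remains is the total length
    of the gaps.  The bound therefore does not depend on the subdivision. *)
Lemma chain_area_rounded_le (R : realType) (gamma : R -> 'rV[R]_2) (C lam : R)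
    (t : nat -> R) (n N M : nat) :
  half_holder C gamma -> 0 < C -> 0 < lam -> subdivision t n -> (N <= M)%N ->
  `|chain_area (rounded gamma M \o t) n - chain_area (rounded gamma N \o t) n| <=
  jump_weight C lam * 2 * \sum_(N <= m < M) level_energy gamma m +
  10 * C * lam / (1 - dyadic_ratio R).
Proof.
move=> H C0 lam0 tP NM.
have /andP[r0 r1] := dyadic_ratio_itv R.
rewrite -(telescope_sumr (fun m => chain_area (rounded gamma m \o t) n) NM).
apply: (le_trans (ler_norm_sum _ _ _)).
apply: (le_trans (ler_sum _ (fun m _ => chain_area_level_step m H C0 lam0 tP))).
rewrite big_split/= -!mulr_sumr mulrA lerD2l ler_wpM2l//.
  by rewrite !mulr_ge0// ltW.
rewrite exchange_big/=.
have -> : (1 - dyadic_ratio R)^-1 =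
    \sum_(0 <= i < n) gap_root t i ^+ 4 / (1 - dyadic_ratio R).
  by rewrite -mulr_suml gap_root_sum// mul1r.
apply: ler_sum => i _.
rewrite -mulr_sumr (exprSr _ 3) -mulrA ler_wpM2l ?exprn_ge0 ?sqrtr_ge0//.
apply: le_trans (geometric_cutoff_le M (dyadic_ratio_itv R) (sqrtr_ge0 _)).
rewrite [leRHS](@big_cat_nat _ _ _ N)//= lerDr sumr_ge0// => m _.
by rewrite mulr_ge0// dyadic_ratioX_ge0.
Qed.

Lemma cvg_wedge (R : realType) (u v : nat -> 'rV[R]_2) (p q : 'rV[R]_2) :
  u n @[n --> \oo] --> p -> v n @[n --> \oo] --> q ->
  wedge (u n) (v n) @[n --> \oo] --> wedge p q.
Proof.
move=> up vq.
have uc k : u n 0 k @[n --> \oo] --> p 0 k.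
  apply: (@cvg_comp _ _ _ u (fun M : 'rV[R]_2 => M 0 k) _ _ _ up).
  exact: coord_continuous.
have vc k : v n 0 k @[n --> \oo] --> q 0 k.
  apply: (@cvg_comp _ _ _ v (fun M : 'rV[R]_2 => M 0 k) _ _ _ vq).
  exact: coord_continuous.
apply: cvgM; first exact: cvg_cst.
by apply: cvgB; apply: cvgM.
Qed.

Lemma cvg_rounded (R : realType) (gamma : R -> 'rV[R]_2) (C t : R) :
  half_holder C gamma -> 0 <= t <= 1 ->
  rounded gamma m t @[m --> \oo] --> gamma t.
Proof.
move=> H tP; have /andP[r0 r1] := dyadic_ratio_itv R.
apply/cvgrPdist_le => e e0.
have : C * (dyadic_ratio R ^+ m) ^+ 2 @[m --> \oo] --> C * (0 * 0).
  apply: cvgM; first exact: cvg_cst.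
  by apply: cvgM; apply: cvg_expr; rewrite ger0_norm// ltW.
rewrite !mul0r mulr0 => /cvgrPdist_le/(_ e e0).
apply: filterS => m; rewrite sub0r normrN => /(le_trans (ler_norm _)).
apply: le_trans; have /andP[t0 t1] := tP.
apply: H => //; [by apply: dyadic_itv; exact: cell_le|exact: dyadic_ratioX_ge0|].
rewrite dyadic_ratioX4; have /andP[h1 h2] := cell_itv m t0.
by rewrite ler_norml; apply/andP; split; lra.
Qed.

Lemma cvg_chain_area_rounded (R : realType) (gamma : R -> 'rV[R]_2) (C : R)
    (t : nat -> R) (n : nat) :
  half_holder C gamma -> subdivision t n ->
  chain_area (rounded gamma m \o t) n @[m --> \oo] --> chain_area (gamma \o t) n.
Proof.
move=> H tP; rewrite /chain_area.
under eq_fun do rewrite big_nat; rewrite big_nat.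
apply: cvg_big; first exact: add_continuous.
move=> i /andP[_ lin]; apply: cvg_wedge; apply: cvg_rounded H _.
  exact: subdivision_itv tP (ltnW lin).
exact: subdivision_itv tP lin.
Qed.

Definition energy_tails_vanish (R : realType) (gamma : R -> 'rV[R]_2) : Prop :=
  forall eps : R, 0 < eps -> exists N : nat, forall M : nat,
    \sum_(N <= m < M) level_energy gamma m <= eps.

(** The heart of the matter: one level [N] serves all partitions that are fine
    enough.  First [lam] is chosen so that the Hoelder error is at most [eps / 2],
    then [N] so that the squared diameters beyond level [N], whose weight depends
    on [lam], contribute at most [eps / 2]. *)
Lemma chain_area_near_dyadic (R : realType) (gamma : R -> 'rV[R]_2) (C eps : R) :
  half_holder C gamma -> 0 < C -> energy_tails_vanish gamma -> 0 < eps ->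
  exists N : nat, forall (t : nat -> R) (n : nat), subdivision t n ->
    (forall i, (i < n)%N -> t i.+1 - t i < 2 ^- N) ->
    `|chain_area (gamma \o t) n - chain_area (dyadic_point gamma N) (2 ^ N)|
      <= eps.
Proof.
move=> H C0 tails eps0.
have /andP[r0 r1] := dyadic_ratio_itv R.
(* This makes the last term of [chain_area_rounded_le] equal to [eps / 2]. *)
pose lam := eps * (1 - dyadic_ratio R) / (20 * C).
have lam0 : 0 < lam by rewrite divr_gt0 ?mulr_gt0 ?subr_gt0.
have K0 : 0 < jump_weight C lam.
  exact: jump_weight_gt0.
have [N HN] : exists N : nat, forall M : nat,
    \sum_(N <= m < M) level_energy gamma m <= eps / (4 * jump_weight C lam).
  by apply: tails; rewrite divr_gt0// mulr_gt0.
exists N => t n tP tmesh; have [t0 tn tm] := tP.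
(* With gaps shorter than [2 ^- N] the rounded subdivision meets every cell. *)
have <- : chain_area (rounded gamma N \o t) n =
          chain_area (dyadic_point gamma N) (2 ^ N).
  rewrite -(cell1 R N) -tn.
  apply: (@chain_area_steps _ _ (fun i => cell N (t i))).
    by rewrite t0 cell0.
  move=> i lin; rewrite cell_homo ?tm//= cell_succ_le ?tmesh//.
  by case/andP: (subdivision_itv tP (ltnW lin)).
have cv := cvg_chain_area_rounded H tP.
apply: (@cvgr_to_le _ \oo _ _ (fun M => `|chain_area (rounded gamma M \o t) n -
   chain_area (rounded gamma N \o t) n|)).
  by apply: cvg_norm; apply: cvgB; [exact: cv|exact: cvg_cst].
near=> M.
have NM : (N <= M)%N by near: M; exact: nbhs_infty_ge.
apply: (le_trans (chain_area_rounded_le H C0 lam0 tP NM)).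
have E1 : 10 * C * lam / (1 - dyadic_ratio R) = eps / 2.
  rewrite /lam; field; rewrite !gt_eqF// subr_gt0//.
have E2 : jump_weight C lam * 2 * (eps / (4 * jump_weight C lam)) = eps / 2.
  by field; rewrite gt_eqF.
rewrite E1; have := ler_wpM2l (ltW K0) (HN M).
have := ler_wpM2l (ltW K0) (HN M); lra.
Unshelve. all: by end_near.
Qed.

(** * Signed area as a limit of dyadic areas *)

Lemma exists_exp2_lt (R : realType) (e : R) :
  0 < e -> \forall N \near \oo, 2 ^- N < e.
Proof.
move=> e0; have := near_infty_natSinv_expn_lt (PosNum e0).
by apply: filterS => N /=; rewrite mul1r.
Qed.

Lemma itv_partition_subdivision (R : realType) (s : seq R) :
  itv_partition 0 1 s -> subdivision (nth 1 (0 :: s)) (size s).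
Proof.
move=> sP; split => //; first exact: itv_partition_nth_size sP.
by case: sP => /(pathP 1) sP _ i /sP /ltW.
Qed.

Lemma gap_le_mesh (R : realType) (a b : R) (s : seq R) (i : nat) :
  (i < size s)%N ->
  nth b (a :: s) i.+1 - nth b (a :: s) i <= mesh a b s.
Proof.
move=> lis.
apply: (@le_bigmax_seq _ _ _ _ _ i xpredT
  (fun i => nth b (a :: s) i.+1 - nth b (a :: s) i)) => //.
by rewrite mem_index_iota.
Qed.

Lemma dyadic_gap (R : realType) (N i : nat) :
  i.+1%:R / 2 ^+ N - i%:R / 2 ^+ N = 2 ^- N :> R.
Proof. by rewrite -mulrBl -natr1 addrAC subrr add0r mul1r. Qed.

Lemma exp2V_lt (R : realType) (N M : nat) : (N < M)%N -> 2 ^- M < 2 ^- N :> R.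
Proof.
by move=> NM; rewrite ltf_pV2 ?posrE ?exp2_gt0// ltr_eXn2l// ltr1n.
Qed.

Definition dyadic_partition (R : realType) (N : nat) : seq R :=
  [seq j%:R / 2 ^+ N | j <- iota 1 (2 ^ N)].

Lemma nth_dyadic_partition (R : realType) (N i : nat) : (i <= 2 ^ N)%N ->
  nth 1 (0 :: dyadic_partition R N) i = i%:R / 2 ^+ N.
Proof.
case: i => [|i] iN /=; first by rewrite mul0r.
by rewrite (nth_map 0%N) ?size_iota// nth_iota.
Qed.

Lemma dyadic_partitionP (R : realType) (N : nat) :
  itv_partition 0 1 (dyadic_partition R N).
Proof.
have sz : size (dyadic_partition R N) = (2 ^ N)%N by rewrite size_map size_iota.
split.
  apply/(pathP 1) => i; rewrite sz => iN.
  rewrite (nth_dyadic_partition _ (ltnW iN)).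
  rewrite [ltRHS](nth_dyadic_partition R (i := i.+1) iN).
  by rewrite ltr_pM2r ?invr_gt0 ?exp2_gt0// ltr_nat.
rewrite (last_nth 1) sz nth_dyadic_partition//.
by rewrite natrX divff// gt_eqF// exp2_gt0.
Qed.

Lemma mesh_dyadic_partition (R : realType) (N : nat) (delta : R) :
  2 ^- N < delta -> mesh 0 1 (dyadic_partition R N) < delta.
Proof.
move=> h; rewrite /mesh size_map size_iota big_nat.
apply: bigmax_lt => [|i /andP[_ iN]].
  by rewrite (lt_trans _ h)// invr_gt0 exp2_gt0.
rewrite (nth_dyadic_partition _ (ltnW iN)).
rewrite [X in X - _](nth_dyadic_partition R (i := i.+1) iN).
by rewrite dyadic_gap.
Qed.

(** Two limits can be compared because there are partitions of arbitrarily small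
    mesh, for instance the dyadic ones. *)
Lemma is_signed_area_unique (R : realType) (gamma : R -> 'rV[R]_2) (L L' : R) :
  is_signed_area 0 1 gamma L -> is_signed_area 0 1 gamma L' -> L = L'.
Proof.
move=> hL hL'; apply/eqP; rewrite -subr_eq0 -normr_le0; apply/ler_addgt0Pr => e e0.
have e2 : 0 < e / 2 by rewrite divr_gt0.
have [d d0 hd] := hL _ e2; have [d' d0' hd'] := hL' _ e2.
have [N [Nd Nd']] : exists N : nat, 2 ^- N < d /\ 2 ^- N < d'.
  near \oo => N; exists N; split; near: N; exact: exists_exp2_lt.
have := hd _ (dyadic_partitionP R N) (mesh_dyadic_partition Nd).
have := hd' _ (dyadic_partitionP R N) (mesh_dyadic_partition Nd').
set A := area_sum _ _ _ _; rewrite add0r.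
rewrite !ltr_norml ler_norml => /andP[? ?] /andP[? ?].
by apply/andP; split; lra.
Unshelve. all: by end_near.
Qed.

Lemma signed_areaE (R : realType) (gamma : R -> 'rV[R]_2) (L : R) :
  is_signed_area 0 1 gamma L -> signed_area 0 1 gamma = L.
Proof.
move=> h; have : is_signed_area 0 1 gamma (signed_area 0 1 gamma).
  by apply: (@xgetPex _ 0 [set L | is_signed_area 0 1 gamma L]); exists L.
by move=> /is_signed_area_unique; exact.
Qed.

Definition dyadic_area (R : realType) (gamma : R -> 'rV[R]_2) (N : nat) : R :=
  chain_area (dyadic_point gamma N) (2 ^ N).

Lemma dyadic_subdivision (R : realType) (N : nat) :
  subdivision (fun j => j%:R / 2 ^+ N : R) (2 ^ N).
Proof.
split; first by rewrite mul0r.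
  by rewrite natrX divff// gt_eqF// exp2_gt0.
by move=> i _; rewrite ler_pM2r ?invr_gt0 ?exp2_gt0// ler_nat.
Qed.

(** Dyadic subdivisions being among those covered by [chain_area_near_dyadic], the
    same estimate shows that the dyadic areas are a Cauchy sequence and that their
    limit is the limit over all partitions. *)
Lemma signed_area_dyadic_limit (R : realType) (gamma : R -> 'rV[R]_2) (C : R) :
  half_holder C gamma -> 0 < C -> energy_tails_vanish gamma ->
  exists2 L : R, is_signed_area 0 1 gamma L &
    dyadic_area gamma N @[N --> \oo] --> L.
Proof.
move=> H C0 tails.
have near_dyadic (e : R) : 0 < e -> exists N : nat, forall N' : nat, (N < N')%N ->
    `|dyadic_area gamma N' - dyadic_area gamma N| <= e.
  move=> e0; have [N HN] := chain_area_near_dyadic H C0 tails e0.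
  exists N => N' NN'; apply: (HN _ _ (dyadic_subdivision R N')) => i _.
  by rewrite dyadic_gap exp2V_lt.
have /cauchy_cvgP : cauchy (dyadic_area gamma N @[N --> \oo]).
  apply: cauchy_exP => e e0.
  have e2 : 0 < e / 2 by rewrite divr_gt0.
  have [N HN] := near_dyadic _ e2; exists (dyadic_area gamma N).
  exists N.+1 => // N' /= NN'; rewrite /ball/= distrC.
  by rewrite (le_lt_trans (HN _ NN'))// ltr_pdivrMr// ltr_pMr// ltr1n.
move=> cv; exists (limn (dyadic_area gamma)) => //.
set L := limn _ in cv *.
move=> e e0; have e2 : 0 < e / 3 by rewrite divr_gt0.
have [N HN] := chain_area_near_dyadic H C0 tails e2.
exists (2 ^- N); first by rewrite invr_gt0 exp2_gt0.
move=> s sP sm; rewrite area_sumE.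
have := HN _ _ (itv_partition_subdivision sP) (fun i lis =>
  le_lt_trans (gap_le_mesh 0 1 lis) sm).
rewrite -/(dyadic_area gamma N).
have : `|L - dyadic_area gamma N| <= e / 3.
  apply: (@cvgr_to_le _ \oo _ _ (fun M => `|dyadic_area gamma M -
    dyadic_area gamma N|)).
    by apply: cvg_norm; apply: cvgB; [exact: cv|exact: cvg_cst].
  exists N.+1 => // M /= NM.
  apply: (HN _ _ (dyadic_subdivision R M)) => i _.
  by rewrite dyadic_gap exp2V_lt.
rewrite ltr_norml !ler_norml => /andP[? ?] /andP[? ?].
by apply/andP; split; lra.
Qed.

(** * Curves satisfying the two conditions *)

Lemma half_holder_of_holder_on (R : realType) (gamma : R -> 'rV[R]_2) :
  holder_on 2^-1 0 1 gamma -> exists2 C : R, 0 < C & half_holder C gamma.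
Proof.
move=> [C0 HC]; exists (`|C0| + 1); first by rewrite ltr_pwDr.
move=> s t x hs ht x0 hst; apply: (le_trans (eucl_dist_ge _ _)).
apply: (le_trans (HC s t _ _)); rewrite ?in_itv//.
rewrite powR12_sqrt//.
have h : Num.sqrt `|s - t| <= x ^+ 2.
  by rewrite -(ger0_norm (sqr_ge0 x)) -(sqrtr_sqr (x ^+ 2)) ler_sqrt ?sqr_ge0// -exprM.
have c1 : C0 <= `|C0| + 1 by rewrite (le_trans (ler_norm _))// lerDl.
apply: (le_trans (ler_wpM2r (sqrtr_ge0 _) c1)).
by rewrite ler_wpM2l// addr_ge0.
Qed.

Lemma energy_tails_vanish_of_sigma (R : realType) (gamma : R -> 'rV[R]_2) :
  (dyadic_sigma gamma < +oo)%E -> energy_tails_vanish gamma.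
Proof.
move=> sfin e e0.
have E0 k : (0 <= (level_energy gamma k)%:E)%E.
  by rewrite lee_fin sumr_ge0// => j _; rewrite sqr_ge0.
have := nneseries_tail_cvg sfin (fun k _ => E0 k).
move=> /fine_cvgP[finT /cvgrPdist_le/(_ e e0) smallT].
have [N [fN sN]] : exists N : nat,
    (\sum_(N <= k <oo) (level_energy gamma k)%:E)%E \is a fin_num /\
    fine (\sum_(N <= k <oo) (level_energy gamma k)%:E)%E <= e.
  near \oo => N; exists N; split; first by near: N.
  apply: le_trans (ler_norm _) _; rewrite -normrN -sub0r; near: N.
  exact: smallT.
exists N => M; rewrite -lee_fin -sumEFin.
apply: le_trans (nneseries_lim_ge M (fun k _ _ => E0 k)) _.
by rewrite -(fineK fN) lee_fin.
Unshelve. all: by end_near.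
Qed.

Definition lipschitz_unit (R : realType) (K : R) (gamma : R -> 'rV[R]_2) : Prop :=
  forall s t : R, 0 <= s -> s <= t -> t <= 1 ->
    `|gamma t - gamma s| <= K * (t - s).

Lemma half_holder_of_lipschitz (R : realType) (K : R) (gamma : R -> 'rV[R]_2) :
  0 <= K -> lipschitz_unit K gamma -> half_holder K gamma.
Proof.
move=> K0 H s t x /andP[s0 s1] /andP[t0 t1] x0 hst.
have hK : `|gamma s - gamma t| <= K * `|s - t|.
  have [st|ts] := leP s t.
    by rewrite distrC [`|s - t|]distrC (@ger0_norm _ (t - s)) ?subr_ge0// H.
  by rewrite (@ger0_norm _ (s - t)) ?subr_ge0 ?(ltW ts)// H// ltW.
apply: (le_trans hK); rewrite ler_wpM2l//.
have [x1|x1] := leP x 1.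
  apply: (le_trans hst); rewrite (exprM x 2 2) -[leRHS]expr1 ler_wiXn2l ?sqr_ge0//.
  by rewrite expr_le1.
apply: (@le_trans _ _ 1); last by rewrite exprn_ege1// ltW.
by rewrite ler_norml; apply/andP; split; lra.
Qed.

Lemma dyadic_diam_lipschitz (R : realType) (K : R) (gamma : R -> 'rV[R]_2) m j :
  0 <= K -> lipschitz_unit K gamma -> (j < 2 ^ m)%N ->
  dyadic_diam gamma m j <= 2 * K * 2 ^- m.
Proof.
move=> K0 H jm.
have jm2 : ((2 * j + 1)%N <= 2 ^ m.+1)%N by rewrite expnS; lia.
have /andP[a0 a1] := dyadic_itv R (ltnW jm).
have /andP[b0 b1] := dyadic_itv R jm.
have E : j.+1%:R / 2 ^+ m = j%:R / 2 ^+ m + 2 ^- m :> R by have := dyadic_gap R m j; lra.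
have E' : (2 * j + 1)%:R / 2 ^+ m.+1 = j%:R / 2 ^+ m + 2 ^- m / 2 :> R.
  by rewrite exprS natrD natrM; field; rewrite gt_eqF ?exp2_gt0.
have m0 : 0 < 2 ^- m :> R by rewrite invr_gt0 exp2_gt0.
have hK (s t : R) : j%:R / 2 ^+ m <= s <= j.+1%:R / 2 ^+ m ->
    j%:R / 2 ^+ m <= t <= j.+1%:R / 2 ^+ m ->
    eucl_dist (gamma s) (gamma t) <= 2 * K * 2 ^- m.
  move=> /andP[s0 s1] /andP[t0 t1].
  apply: (le_trans (eucl_dist_le _ _)); rewrite -mulrA ler_wpM2l//.
  have [st|ts] := leP s t.
    rewrite distrC (le_trans (H _ _ (le_trans a0 s0) st (le_trans t1 b1)))//.
    by rewrite ler_wpM2l//; lra.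
  rewrite (le_trans (H _ _ (le_trans a0 t0) (ltW ts) (le_trans s1 b1)))//.
  by rewrite ler_wpM2l//; lra.
pose inside (x : R) := j%:R / 2 ^+ m <= x <= j.+1%:R / 2 ^+ m.
have l : inside (j%:R / 2 ^+ m) by apply/andP; split; lra.
have c : inside ((2 * j + 1)%:R / 2 ^+ m.+1) by apply/andP; split; lra.
have r : inside (j.+1%:R / 2 ^+ m) by apply/andP; split; lra.
by apply: diam3_le => p q [[->|->]|->] [[->|->]|->]; exact: hK.
Qed.

Lemma level_energy_lipschitz (R : realType) (K : R) (gamma : R -> 'rV[R]_2) m :
  0 <= K -> lipschitz_unit K gamma ->
  level_energy gamma m <= (2 * K) ^+ 2 * 2 ^- m.
Proof.
move=> K0 H; rewrite /level_energy big_nat.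
apply: (@le_trans _ _ (\sum_(0 <= j < 2 ^ m) (2 * K * 2 ^- m) ^+ 2)).
  rewrite [leRHS]big_nat; apply: ler_sum => j /andP[_ jm].
  rewrite ler_pXn2r ?nnegrE ?dyadic_diam_ge0 ?dyadic_diam_lipschitz//.
  by rewrite !mulr_ge0// invr_ge0 ltW// exp2_gt0.
have mulXE (x : R) : x *+ (2 ^ m) = x * 2 ^+ m by rewrite -natrX mulr_natr.
rewrite sumr_const_nat subn0 mulXE.
rewrite le_eqVlt; apply/orP; left; apply/eqP.
by field; rewrite gt_eqF ?exp2_gt0.
Qed.

Lemma exp2VS (R : realType) (m : nat) : 2 ^- m.+1 = 2^-1 * 2 ^- m :> R.
Proof. by rewrite exprS invfM. Qed.

(** For a Lipschitz curve the [2 ^ m] squared diameters of level [m] are of order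
    [4 ^- m] each, so the energies decay geometrically. *)
Lemma energy_tails_vanish_of_lipschitz (R : realType) (K : R)
    (gamma : R -> 'rV[R]_2) :
  0 <= K -> lipschitz_unit K gamma -> energy_tails_vanish gamma.
Proof.
move=> K0 H e e0; pose A := 2 * (2 * K) ^+ 2 + 1.
have A0 : 0 < A by rewrite ltr_pwDr// mulr_ge0// sqr_ge0.
have [N HN] : exists N, 2 ^- N < e / A.
  by near \oo => N; exists N; near: N; apply: exists_exp2_lt; rewrite divr_gt0.
exists N => M.
have sumE : \sum_(N <= m < M) 2 ^- m <= 2 * 2 ^- N :> R.
  have [MN|NM] := leqP M N.
    by rewrite big_geq// mulr_ge0// invr_ge0 ltW// exp2_gt0.
  have E : \sum_(N <= m < M) 2 ^- m = 2 * 2 ^- N - 2 * 2 ^- M :> R.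
    elim: M NM => // M IH; rewrite ltnS leq_eqVlt => /orP[/eqP<-|NM].
      by rewrite big_nat1 exp2VS; lra.
    by rewrite (big_nat_recr _ _ _ (ltnW NM))/= IH// exp2VS; lra.
  by rewrite E gerBl mulr_ge0// invr_ge0 ltW// exp2_gt0.
have h1 : \sum_(N <= m < M) level_energy gamma m <=
    (2 * K) ^+ 2 * \sum_(N <= m < M) 2 ^- m.
  by rewrite mulr_sumr; apply: ler_sum => m _; exact: level_energy_lipschitz.
apply: (le_trans h1).
have := ler_wpM2l (sqr_ge0 (2 * K)) sumE => /le_trans; apply.
move: HN; rewrite ltr_pdivlMr// => HN; apply: le_trans (ltW HN).
have : 0 < 2 ^- N :> R by rewrite invr_gt0 exp2_gt0.
by rewrite /A; lra.
Unshelve. all: by end_near.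
Qed.

(** * Polygonal curves *)

(** Unlike the definition, this includes the right endpoint of the segment. *)
Lemma polygonal_segment (R : realType) (n k : nat) (v : nat -> 'rV[R]_2) (t : R) :
  k%:R <= n%:R * t <= k.+1%:R ->
  polygonal n v t = v k + (n%:R * t - k%:R) *: (v k.+1 - v k).
Proof.
move=> /andP[h1]; rewrite le_eqVlt => /orP[/eqP h2|h2].
  rewrite /polygonal h2 natrK subrr scale0r addr0 subr0 scale1r.
  by rewrite -natr1 addrAC subrr add0r scale1r addrC subrK.
rewrite /polygonal (truncn_def (n := k)) ?h1//.
by rewrite scalerBl scale1r scalerBr -addrA [- _ + _]addrC.
Qed.

Lemma sum_steps_le (R : realType) (v : nat -> 'rV[R]_2) (K : R) (n a b : nat) :
  (forall j, (j <= n)%N -> `|v j.+1 - v j| <= K) ->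
  (a <= b)%N -> (b <= n.+1)%N -> `|v b - v a| <= K * (b%:R - a%:R).
Proof.
move=> HK; elim: b => [|b IH].
  by rewrite leqn0 => /eqP -> _; rewrite !subrr normr0 mulr0.
rewrite leq_eqVlt => /orP[/eqP <- _|ab bn]; first by rewrite !subrr normr0 mulr0.
have := IH ab (ltnW bn); have := HK b bn.
have : `|v b.+1 - v a| <= `|v b.+1 - v b| + `|v b - v a|.
  by rewrite (le_trans _ (ler_normD _ _))// addrA subrK.
by rewrite -natr1; lra.
Qed.

(** The constant may include the step from [v n] to [v n.+1], which only enters
    with weight 0. *)
Lemma polygonal_lipschitz (R : realType) (n : nat) (v : nat -> 'rV[R]_2) :
  exists2 K : R, 0 <= K & lipschitz_unit K (polygonal n v).
Proof.
pose K := \sum_(0 <= j < n.+1) `|v j.+1 - v j|.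
have K0 : 0 <= K by rewrite sumr_ge0.
have HK j : (j <= n)%N -> `|v j.+1 - v j| <= K.
  move=> jn; rewrite /K (bigD1_seq j) ?iota_uniq ?mem_index_iota//=.
  by rewrite lerDl sumr_ge0.
exists (K * n%:R); first by rewrite mulr_ge0.
move=> s t s0 st t1.
have n0 : 0 <= n%:R :> R := ler0n R n.
rewrite -mulrA mulrBr.
have hx : 0 <= n%:R * s by rewrite mulr_ge0.
have hxy : n%:R * s <= n%:R * t by rewrite ler_wpM2l.
have hy : n%:R * t <= n%:R by rewrite ler_piMr.
have /andP[j1 j2] := truncn_itv hx.
have /andP[k1 k2] := truncn_itv (le_trans hx hxy).
have jk := le_truncn hxy.
have kn : (Num.truncn (n%:R * t) <= n)%N.
  by rewrite truncn_le_nat (le_lt_trans hy)// ltr_nat.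
rewrite (@polygonal_segment _ n (Num.truncn (n%:R * s)) v s) ?j1 ?(ltW j2)//.
rewrite (@polygonal_segment _ n (Num.truncn (n%:R * t)) v t) ?k1 ?(ltW k2)//.
set x := n%:R * s in hx hxy j1 j2 jk *; set y := n%:R * t in hxy hy k1 k2 jk kn *.
set j := Num.truncn x in j1 j2 jk *; set k := Num.truncn y in k1 k2 jk kn *.
have jn := leq_trans jk kn.
move: jk; rewrite leq_eqVlt => /orP[/eqP jk|jk].
  rewrite -jk.
  have -> : v j + (y - j%:R) *: (v j.+1 - v j) -
      (v j + (x - j%:R) *: (v j.+1 - v j)) = (y - x) *: (v j.+1 - v j).
    by apply/rowP => i; rewrite !mxE; ring.
  by rewrite normrZ ger0_norm ?subr_ge0// mulrC ler_wpM2r ?subr_ge0// HK.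
have -> : v k + (y - k%:R) *: (v k.+1 - v k) -
    (v j + (x - j%:R) *: (v j.+1 - v j)) =
    (y - k%:R) *: (v k.+1 - v k) + (v k - v j.+1) +
    (j.+1%:R - x) *: (v j.+1 - v j).
  by apply/rowP => i; rewrite !mxE -natr1; ring.
have h1 : `|(y - k%:R) *: (v k.+1 - v k)| <= (y - k%:R) * K.
  by rewrite normrZ ger0_norm ?subr_ge0// ler_wpM2l ?subr_ge0// HK.
have h2 : `|(j.+1%:R - x) *: (v j.+1 - v j)| <= (j.+1%:R - x) * K.
  by rewrite normrZ ger0_norm ?subr_ge0 ?(ltW j2)// ler_wpM2l ?subr_ge0
    ?(ltW j2)// HK.
have h3 := sum_steps_le HK jk (leqW kn).
apply: (le_trans (ler_normD _ _)).
have := ler_normD ((y - k%:R) *: (v k.+1 - v k)) (v k - v j.+1).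
lra.
Qed.

Lemma sum_nat_pairs (V : nmodType) (F : nat -> V) (n : nat) :
  \sum_(0 <= j < 2 * n) F j =
  \sum_(0 <= j < n) (F (2 * j)%N + F (2 * j + 1)%N).
Proof.
elim: n => [|n IH]; first by rewrite muln0 !big_nil.
by rewrite mulnS add2n !big_nat_recr//= IH -addrA addn1.
Qed.

Lemma wedge_midpoint (R : realType) (p q : 'rV[R]_2) :
  wedge p (2^-1 *: (p + q)) + wedge (2^-1 *: (p + q)) q = wedge p q.
Proof. by rewrite /wedge !mxE; field. Qed.

(** From level [i] on, every dyadic interval lies in one segment of the
    polygonal curve, which is affine there. *)
Lemma polygonal_midpoint (R : realType) (gamma : R -> 'rV[R]_2) (i d j : nat) :
  let g := dyadic_polygonal gamma i in
  dyadic_point g (i + d).+1 (2 * j + 1) =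
  2^-1 *: (dyadic_point g (i + d) j + dyadic_point g (i + d) j.+1).
Proof.
move=> g; pose k := (j %/ 2 ^ d)%N.
pose w := fun l : nat => gamma (l%:R / 2 ^+ i).
have d0 := exp2_gt0 R d; have i0 := exp2_gt0 R i.
have S (y : R) : j%:R <= y <= j.+1%:R ->
    g (y / 2 ^+ (i + d)) = w k + (y / 2 ^+ d - k%:R) *: (w k.+1 - w k).
  move=> /andP[y0 y1].
  have E : (2 ^ i)%:R * (y / 2 ^+ (i + d)) = y / 2 ^+ d.
    by rewrite natrX exprD; field; rewrite !gt_eqF.
  rewrite /g /dyadic_polygonal (@polygonal_segment _ _ k) E//.
  rewrite ler_pdivlMr// ler_pdivrMr// -natrX -!natrM.
  apply/andP; split.
    by rewrite (le_trans _ y0)// ler_nat leq_divM.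
  by rewrite (le_trans y1)// ler_nat ltn_ceil// expn_gt0.
rewrite /dyadic_point.
have -> : (2 * j + 1)%:R / 2 ^+ (i + d).+1 = (j%:R + 2^-1) / 2 ^+ (i + d) :> R.
  by rewrite natrD natrM exprS; field; rewrite gt_eqF ?exp2_gt0.
have jS : j.+1%:R = j%:R + 1 :> R by rewrite natr1.
rewrite !S; [|by apply/andP; split; lra..].
by rewrite jS; apply/rowP => l; rewrite !mxE; field; rewrite gt_eqF.
Qed.

(** Subdividing a segment at its midpoint does not change the area. *)
Lemma dyadic_area_polygonal (R : realType) (gamma : R -> 'rV[R]_2) (i d : nat) :
  dyadic_area (dyadic_polygonal gamma i) (i + d) = dyadic_area gamma i.
Proof.
elim: d => [|d IH].
  rewrite addn0 /dyadic_area; congr chain_area; apply/funext => j.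
  rewrite /dyadic_point /dyadic_polygonal.
  have E : (2 ^ i)%:R * (j%:R / 2 ^+ i) = j%:R :> R.
    by rewrite natrX mulrC divfK// gt_eqF// exp2_gt0.
  rewrite (@polygonal_segment _ _ j) E; last by rewrite lexx ler_nat leqnSn.
  by rewrite subrr scale0r addr0.
rewrite -IH addnS /dyadic_area /chain_area expnS sum_nat_pairs.
apply: eq_bigr => j _.
have -> : (2 * j + 1).+1 = (2 * j.+1)%N by lia.
by rewrite -[(2 * j).+1]addn1 polygonal_midpoint !dyadic_point_double wedge_midpoint.
Qed.

(** A polygonal curve is Lipschitz, hence satisfies the hypotheses of
    [signed_area_dyadic_limit]; its dyadic areas are constant from level [i] on. *)
Lemma is_signed_area_polygonal (R : realType) (gamma : R -> 'rV[R]_2) (i : nat) :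
  is_signed_area 0 1 (dyadic_polygonal gamma i) (dyadic_area gamma i).
Proof.
have [K K0 HK] := polygonal_lipschitz (2 ^ i) (fun j => gamma (j%:R / 2 ^+ i)).
have K1 : 0 < K + 1 by rewrite ltr_pwDr.
have HK1 : lipschitz_unit (K + 1) (dyadic_polygonal gamma i).
  move=> s t s0 st t1; apply: (le_trans (HK s t s0 st t1)).
  by rewrite ler_wpM2r ?subr_ge0// lerDl.
have [L hL cL] := signed_area_dyadic_limit
  (half_holder_of_lipschitz (ltW K1) HK1) K1
  (energy_tails_vanish_of_lipschitz (ltW K1) HK1).
suff -> : dyadic_area gamma i = L by [].
suff c : dyadic_area (dyadic_polygonal gamma i) N @[N --> \oo]
    --> dyadic_area gamma i.
  exact: (cvg_unique (@Rhausdorff R) c cL).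
apply: cvg_near_cst; exists i => // N /= iN.
by rewrite -(subnKC iN) dyadic_area_polygonal.
Qed.

Theorem theorem1p2 (R : realType) (gamma : R -> 'rV[R]_2) :
  holder_on 2^-1 0 1 gamma ->
  (dyadic_sigma gamma < +oo)%E ->
  [/\ signed_area_exists 0 1 gamma,
      forall i : nat, signed_area_exists 0 1 (dyadic_polygonal gamma i) &
      signed_area 0 1 (dyadic_polygonal gamma i) @[i --> \oo]
        --> signed_area 0 1 gamma].
Proof.
move=> /half_holder_of_holder_on[C C0 H] /energy_tails_vanish_of_sigma tails.
have [L hL cL] := signed_area_dyadic_limit H C0 tails.
split; first by exists L.
  by move=> i; exists (dyadic_area gamma i); exact: is_signed_area_polygonal.
rewrite (signed_areaE hL).
under eq_fun do rewrite (signed_areaE (is_signed_area_polygonal _ _)).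
exact: cL.
Qed.
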